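(* Let $\mathcal{A}=\{0,\ldots,n-1\}$ for some $n\in\mathbb{N}$, and let $\lceil\cdot\rceil,\lfloor\cdot\rfloor:\mathcal{A}\rightarrow\{0,1\}^*$ be two Deflate codings such that $\operatorname{len}\lceil x\rceil=\operatorname{len}\lfloor x\rfloor$ for all $x\in\mathcal{A}$. Then $\lceil x\rceil=\lfloor x\rfloor$ for all $x\in\mathcal{A}$.
   Context: $\{0,1\}^*$ is the set of finite bit lists, $[\,]$ is the empty list, $::$ is cons, $+\!\!+$ is concatenation, $\{0,1\}^+$ is the set of nonempty bit lists. For bit lists $a,b$, write $a\preccurlyeq b$ ($a$ is a prefix of $b$) if there is $c\in\{0,1\}^*$ with $a+\!\!+c=b$. The lexicographical ordering $\sqsubseteq$ on $\{0,1\}^*$ is the least relation with $[\,]\sqsubseteq a$ for all $a$; $0::a\sqsubseteq 1::b$ for all $a,b$; and $j::a\sqsubseteq j::b$ whenever $a\sqsubseteq b$ (for $j\in\{0,1\}$). A Deflate coding is a map $\lceil\cdot\rceil:\mathcal{A}\to\{0,1\}^*$ such that: (1) for all $a\neq b$ with $\lceil a\rceil\neq[\,]$, $\lceil a\rceil\not\preccurlyeq\lceil b\rceil$; (2) for all $a,b$, if $\operatorname{len}\lceil a\rceil<\operatorname{len}\lceil b\rceil$ then $\lceil a\rceil\sqsubseteq\lceil b\rceil$; (3) for all $a,b$, if $\operatorname{len}\lceil a\rceil=\operatorname{len}\lceil b\rceil$ and $a\le b$ then $\lceil a\rceil\sqsubseteq\lceil b\rceil$; (4) for all $a\in\mathcal{A}$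 and $l\in\{0,1\}^+$, if $l\sqsubseteq\lceil a\rceil$ and $\operatorname{len} l=\operatorname{len}\lceil a\rceil$, then there exists $b\in\mathcal{A}$ with $\lceil b\rceil\neq[\,]$ and $\lceil b\rceil\preccurlyeq l$. *)

(* Defs.v *)
(* MathComp. A bit list is a [seq bool], with [false] for 0 and [true] for 1. *)
From mathcomp Require Import all_boot all_order.
Import Order.TTheory.

Set Implicit Arguments.
Unset Strict Implicit.
Unset Printing Implicit Defensive.

Inductive lexle : seq bool -> seq bool -> Prop :=
| lexle_nil a : lexle [::] a
| lexle_01 a b : lexle (false :: a) (true :: b)
| lexle_cons j a b : lexle a b -> lexle (j :: a) (j :: b).

Lemma lexleP (a b : seq bool) :
  reflect (lexle a b) ((a : seqlexi bool) <= (b : seqlexi bool))%O.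
Proof.
apply: (iffP idP).
  elim: a b => [|i a IH] [|j b] //; try by move=> _; apply: lexle_nil.
  rewrite lexi_cons.
  case: i; case: j => //= H; last by apply: lexle_cons; apply: IH.
    by apply: lexle_cons; apply: IH.
  exact: lexle_01.
elim=> {a b} [a|a b|j a b _ IH] //.
by rewrite lexi_cons lexx.
Qed.

(* A code may be empty: such symbols do not occur in the encoded data, and
   several symbols may share the empty code. *)
Record deflate_coding (n : nat) (c : 'I_n -> seq bool) : Prop := DeflateCoding {
  deflate_prefix_free : forall a b : 'I_n,
    a <> b -> c a <> [::] -> ~ prefix (c a) (c b);
  deflate_size_lexle : forall a b : 'I_n,
    size (c a) < size (c b) -> lexle (c a) (c b);
  deflate_order_lexle : forall a b : 'I_n,
    size (c a) = size (c b) -> a <= b -> lexle (c a) (c b);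
  deflate_no_gap : forall (a : 'I_n) (l : seq bool),
    l <> [::] -> lexle l (c a) -> size l = size (c a) ->
    exists b : 'I_n, c b <> [::] /\ prefix (c b) l
}.

(* Main.v *)
(** Induct on symbols ordered by code length, then by index. Suppose the codings
    [c] and [d] agree on all symbols before [x] and, by symmetry, that [c x] is
    lexicographically at most [d x]. Since [d] leaves no gap, some nonempty [d b]
    is a prefix of [c x]. If [b] comes before [x] then [d b = c b], contradicting
    prefix-freeness of [c]. Otherwise [d b = c x] has the length of [d x], and
    monotonicity of [d] gives [d x <= d b = c x], whence [c x = d x]. *)
Require Import Defs.
From mathcomp Require Import all_boot all_order.
Import Order.TTheory.

Lemma lexle_anti (a b : seq bool) : lexle a b -> lexle b a -> a = b.
Proof.
move=> /lexleP ab /lexleP ba.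
by apply: (@le_anti _ (seqlexi bool)); rewrite ab ba.
Qed.

Lemma lexle_total (a b : seq bool) : lexle a b \/ lexle b a.
Proof.
have /orP[/lexleP|/lexleP] := le_total (a : seqlexi bool) (b : seqlexi bool).
  by left.
by right.
Qed.

Lemma prefix_leq_size (s t : seq bool) : prefix s t -> size t <= size s -> s = t.
Proof.
move=> /prefixP[u ->]; rewrite size_cat -[leqRHS]addn0 leq_add2l leqn0.
by move=> /nilP ->; rewrite cats0.
Qed.

Lemma deflate_lexle_eq (n : nat) (c d : 'I_n -> seq bool) (x : 'I_n) :
  deflate_coding c -> deflate_coding d ->
  (forall y, size (c y) = size (d y)) ->
  (forall y, size (c y) < size (c x) -> c y = d y) ->
  (forall y, size (c y) = size (c x) -> y < x -> c y = d y) ->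
  lexle (c x) (d x) -> c x = d x.
Proof.
move=> hc hd hsize eq_shorter eq_before le_cd.
(* The no-gap condition covers only nonempty lists; an empty code is settled by its length. *)
have [cx0|/eqP cx_neq0] := eqVneq (c x) [::].
  by have := hsize x; rewrite cx0 => /esym/size0nil ->.
have [b [db_neq0 db_cx]] := deflate_no_gap hd cx_neq0 le_cd (hsize x).
have before_absurd : b <> x -> c b <> d b.
  move=> b_neq_x cb_db; rewrite -cb_db in db_neq0 db_cx.
  exact: (deflate_prefix_free hc b_neq_x db_neq0 db_cx).
have [size_lt|size_ge] := ltnP (size (c b)) (size (c x)).
  (* What remains is [b <> x], clear since the code of [b] is strictly shorter. *)
  case: (before_absurd _ (eq_shorter b size_lt)) => b_x.
  by rewrite b_x ltnn in size_lt.
have db_eq : d b = c x by apply: prefix_leq_size; rewrite // -hsize.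
have size_eq : size (c b) = size (c x) by rewrite hsize db_eq.
have [b_lt|x_le] := ltnP b x.
  case: (before_absurd _ (eq_before b size_eq b_lt)) => b_x.
  by rewrite b_x ltnn in b_lt.
apply: lexle_anti => //; rewrite -db_eq.
by apply: (deflate_order_lexle hd) => //; rewrite -!hsize.
Qed.

Theorem theorem1 (n : nat) (c d : 'I_n -> seq bool)
    (hc : deflate_coding c) (hd : deflate_coding d)
    (hsize : forall x : 'I_n, size (c x) = size (d x)) :
  forall x : 'I_n, c x = d x.
Proof.
move=> x; have [k] := ubnP (size (c x)).
(* Nested induction: [k] bounds the code length, then [m] bounds the index among codes of length at
   most [k]. *)
elim: k x => // k IHk x; rewrite ltnS => size_le.
have [m] := ubnP (x : nat).
elim: m x size_le => // m IHm x size_le; rewrite ltnS => x_le.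
have eq_shorter y : size (c y) < size (c x) -> c y = d y.
  by move=> lt_yx; apply: IHk; apply: leq_trans size_le.
have eq_before y : size (c y) = size (c x) -> y < x -> c y = d y.
  move=> size_eq lt_yx.
  by apply: IHm; [rewrite size_eq | apply: leq_trans x_le].
have [le_cd|le_dc] := lexle_total (c x) (d x).
  exact: deflate_lexle_eq.
(* With the codings swapped, equal lengths carry the induction hypotheses over to [d]. *)
apply/esym/(deflate_lexle_eq _ _ _ _ hd hc) => // y; rewrite -!hsize.
  by move=> /eq_shorter.
by move=> size_eq /(eq_before y size_eq).
Qed.
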